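(* Let $n\ge1$ and let $f=(\alpha_f,\sigma_f)\in G_n$ be reversible in $G_n$. Then $f$ is strongly reversible in $G_n$.
   Context: An interval exchange transformation (IET) is a bijection of $[0,1)$ defined by a finite partition of $[0,1)$ into half-open subintervals and a reordering of these intervals by translations. Let $\mathcal S_n$ be the group of permutations of $\{1,\dots,n\}$, $\mathbb S_n=[0,\frac1n]/(0=\frac1n)\cong\mathbb R/\frac1n\mathbb Z$, and $I_i=[\frac{i-1}{n},\frac in)$. $G_n$ is the group of IETs $g$ for which there are $\sigma_g\in\mathcal S_n$ and $\alpha_g=(\alpha_1(g),\dots,\alpha_n(g))\in\mathbb S_n^n$ such that $g$ maps $I_i$ onto $I_{\sigma_g(i)}$ by translating $I_i$ to $I_{\sigma_g(i)}$ and then rotating by $\alpha_i(g)$ (mod $\frac1n$ inside $I_{\sigma_g(i)}$); one writes $g=(\alpha_g,\sigma_g)$. An element $f$ of a group $G$ is reversible in $G$ if there is $b\in G$ with $bfb^{-1}=f^{-1}$; it is strongly reversible in $G$ if such a $b$ can be chosen with $b^2=1$. *)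

(* Defs.v *)
From HB Require Import structures.
From mathcomp Require Import all_boot all_order all_fingroup all_algebra.
From mathcomp Require Import boolp reals.
From mathcomp Require Import lra.

Set Implicit Arguments.
Unset Strict Implicit.
Unset Printing Implicit Defensive.

Import Order.TTheory GRing.Theory Num.Theory.
Local Open Scope ring_scope.

Definition reversible (G : groupType) (f : G) : Prop :=
  exists b : G, (b * f * b^-1 = f^-1)%g.

Definition strongly_reversible (G : groupType) (f : G) : Prop :=
  exists b : G, (b * f * b^-1 = f^-1)%g /\ (b ^+ 2 = 1)%g.

(* The half-open interval [0, l). For l = 1 it is the space on which interval *)
(* exchanges act; for l = 1/n it is a fundamental domain of R/(1/n)Z, and its *)
(* elements stand for the points of that circle.                              *)
Definition ico (R : realType) (l : R) := {x : R | 0 <= x < l}.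

Definition mk_ico (R : realType) (l x : R) (xl : 0 <= x < l) : ico l :=
  exist _ x xl.

(* The representative of x modulo l in [0, l), for l > 0. *)
Definition modr (R : realType) (l x : R) : R := x - l * (Num.floor (x / l))%:~R.

Definition piecewise_translation (R : realType) (f : ico (1 : R) -> ico (1 : R))
    : Prop :=
  exists (J : finType) (a b t : J -> R),
  [/\ forall j, 0 <= a j /\ a j < b j /\ b j <= 1,
      forall x : ico 1, exists! j : J, a j <= val x < b j
    & forall (j : J) (x : ico 1), a j <= val x < b j ->
        val (f x) = val x + t j].

Record iet (R : realType) := Iet {
  iet_fun :> ico (1 : R) -> ico (1 : R);
  iet_bij : bijective iet_fun;
  iet_pt : piecewise_translation iet_fun }.

HB.instance Definition _ (R : realType) := gen_eqMixin (iet R).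
HB.instance Definition _ (R : realType) := gen_choiceMixin (iet R).

Section IetGroup.
Variable R : realType.
Implicit Types f g h : iet R.

Lemma iet_eqP f g : f =1 g -> f = g.
Proof.
case: f g => [f f1 f2] [g g1 g2] /= /funext fg.
by case: _ / fg in g1 g2 *; congr Iet; exact: Prop_irrelevance.
Qed.

Lemma pt_id : piecewise_translation (@id (ico (1 : R))).
Proof.
exists unit, (fun=> 0), (fun=> 1), (fun=> 0); split.
- by move=> _; rewrite lexx ltr01.
- by move=> x; exists tt; split => [|[]//]; exact: valP x.
- by move=> _ x _; rewrite addr0.
Qed.

Lemma pt_comp (f g : ico (1 : R) -> ico (1 : R)) :
  piecewise_translation f -> piecewise_translation g ->
  piecewise_translation (g \o f).
Proof.
move=> [J [a [b [t [ab fP ft]]]]] [K [c [d [s [cd gP gs]]]]].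
pose A (p : J * K) := Num.max (a p.1) (c p.2 - t p.1).
pose B (p : J * K) := Num.min (b p.1) (d p.2 - t p.1).
have ABE p x : (A p <= x < B p) =
    (a p.1 <= x < b p.1) && (c p.2 <= x + t p.1 < d p.2).
  rewrite ge_max lt_min lerBlDr ltrBrDr.
  by rewrite andbACA.
exists {p : J * K | A p < B p}, (fun p => A (val p)), (fun p => B (val p)),
  (fun p => t (val p).1 + s (val p).2); split.
- case=> p /= lAB; have [a0 [_ b1]] := ab p.1.
  by split; [rewrite le_max a0|split=> //; rewrite ge_min b1].
- move=> x; have [j [xj ju]] := fP x; have [k [yk ku]] := gP (f x).
  have xAB : A (j, k) <= val x < B (j, k) by rewrite ABE xj /= -(ft j).
  have lAB : A (j, k) < B (j, k) by case/andP: xAB; exact: le_lt_trans.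
  exists (exist _ (j, k) lAB); split=> //= -[[j' k'] /= l'] xAB'.
  apply: val_inj => /=; move: xAB'; rewrite ABE /= => /andP[xj' yk'].
  by rewrite (ju _ xj') (ku k') // (ft j').
- case=> p l x /=; rewrite ABE => /andP[xj yk].
  have fx := ft _ _ xj.
  by rewrite (gs p.2) fx // addrA.
Qed.

Lemma pt_inv (f g : ico (1 : R) -> ico (1 : R)) : cancel f g -> cancel g f ->
  piecewise_translation f -> piecewise_translation g.
Proof.
move=> fK gK [J [a [b [t [ab fP ft]]]]].
have preim j (y : ico 1) : a j + t j <= val y < b j + t j ->
    a j <= val (g y) < b j /\ val (g y) = val y - t j.
  move=> yj; have xj : a j <= val y - t j < b j by lra.
  have [a0 [_ b1]] := ab j.
  have x01 : 0 <= val y - t j < 1 by lra.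
  have fx : f (mk_ico x01) = y.
    by apply: val_inj; rewrite (ft j) //= subrK.
  by rewrite -[y in g y]fx fK.
exists J, (fun j => a j + t j), (fun j => b j + t j), (fun j => - t j); split.
- move=> j; have [a0 [lab b1]] := ab j; split; last split.
  + have a01 : 0 <= a j < 1 by lra.
    have := ft j (mk_ico a01); rewrite lexx lab => /(_ isT) /= <-.
    by case/andP: (valP (f (mk_ico a01))).
  + lra.
  + rewrite leNgt; apply/negP => bt.
    pose x := Num.max (a j) (1 - t j).
    have xj : a j <= x < b j by rewrite le_max lexx gt_max lab; lra.
    have x01 : 0 <= x < 1 by lra.
    have := valP (f (mk_ico x01)); rewrite (ft j) //= => /andP[_].
    by apply/negP; rewrite -leNgt -lerBlDr le_max lexx orbT.
- move=> y; have [j [yj ju]] := fP (g y).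
  exists j; split=> [|j' /preim[/ju]//].
  by rewrite -[y in val y]gK (ft j) // lerD2r ltrD2r.
- by move=> j y /preim[].
Qed.

Definition iet_one := Iet (Bijective (@frefl _ _ id) (@frefl _ _ id)) pt_id.

Definition iet_mul f g :=
  Iet (bij_comp (iet_bij f) (iet_bij g)) (pt_comp (iet_pt g) (iet_pt f)).

Lemma iet_inv_subproof f : {h | cancel f h & cancel h f}.
Proof.
by apply: cid2; have [h fK hK] := iet_bij f; exists h.
Qed.

Definition iet_inv f :=
  let: exist2 h fK hK := iet_inv_subproof f in
  Iet (Bijective hK fK) (pt_inv fK hK (iet_pt f)).

Lemma iet_funK f : cancel f (iet_inv f).
Proof. by rewrite /iet_inv; case: iet_inv_subproof. Qed.

Lemma iet_funVK f : cancel (iet_inv f) f.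
Proof. by rewrite /iet_inv; case: iet_inv_subproof. Qed.

Lemma iet_mulA : associative iet_mul.
Proof. by move=> f g h; exact: iet_eqP. Qed.
Lemma iet_mul1 : left_id iet_one iet_mul.
Proof. by move=> f; exact: iet_eqP. Qed.
Lemma iet_mulr1 : right_id iet_one iet_mul.
Proof. by move=> f; exact: iet_eqP. Qed.
Lemma iet_mulV : left_inverse iet_one iet_inv iet_mul.
Proof. by move=> f; apply: iet_eqP => x; exact: iet_funK. Qed.
Lemma iet_mulrV : right_inverse iet_one iet_inv iet_mul.
Proof. by move=> f; apply: iet_eqP => x; exact: iet_funVK. Qed.

HB.instance Definition _ := isGroup.Build (iet R)
  iet_mulA iet_mul1 iet_mulr1 iet_mulV iet_mulrV.

Lemma ietM f g x : (f * g)%g x = f (g x). Proof. by []. Qed.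

End IetGroup.

(* The intervals are indexed from 0: for i : 'I_n, the interval of index i is *)
(* [i/n, (i+1)/n).                                                            *)
Definition in_piece (R : realType) (n : nat) (i : 'I_n) (x : R) : bool :=
  i%:R / n%:R <= x < i.+1%:R / n%:R.

(* g = (alpha, sigma). *)
Definition rotates_pieces (R : realType) (n : nat)
    (alpha : 'I_n -> ico (n%:R^-1 : R)) (sigma : 'S_n) (g : iet R) : Prop :=
  forall (i : 'I_n) (x : ico 1), in_piece i (val x) ->
    val (g x) = (sigma i)%:R / n%:R
                + modr n%:R^-1 (val x - i%:R / n%:R + val (alpha i)).

Definition Gn_pred (R : realType) (n : nat) : {pred iet R} :=
  fun g => `[< exists alpha sigma, rotates_pieces (n := n) alpha sigma g >].

Arguments Gn_pred R n : clear implicits.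

Section GnClosed.
Variables (R : realType) (n : nat).

Lemma modr_ico (l x : R) : 0 < l -> 0 <= modr l x < l.
Proof.
move=> l0; rewrite /modr; set k := Num.floor _.
have /andP[h1 h2] : k%:~R <= x / l < (k + 1)%:~R by exact: floor_itv.
move: h1 h2; rewrite intrD ler_pdivlMr // ltr_pdivrMr // => h1 h2.
by apply/andP; split; lra.
Qed.

Lemma modr_uniq (l x y : R) (k : int) : 0 <= y < l -> x = y + l * k%:~R ->
  modr l x = y.
Proof.
move=> /andP[y0 yl] ->; have l0 : 0 < l by exact: le_lt_trans yl.
have E : (y + l * k%:~R) / l = y / l + k%:~R.
  by rewrite mulrDl mulrAC mulfV ?gt_eqF// mul1r.
rewrite /modr E (_ : Num.floor _ = k) ?addrK//.
apply: floor_def; rewrite lerDr intrD [ltRHS]addrC ltrD2r.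
by rewrite divr_ge0 ?(ltW l0) // ltr_pdivrMr ?mul1r.
Qed.

Lemma modr_id (l x : R) : 0 <= x < l -> modr l x = x.
Proof. by move=> xl; apply: (@modr_uniq _ _ _ 0) => //; rewrite mulr0 addr0. Qed.

Lemma modrDm (l x y : R) : 0 < l -> modr l (modr l x + y) = modr l (x + y).
Proof.
move=> l0; apply: (@modr_uniq _ _ _ (Num.floor ((x + y) / l) - Num.floor (x / l))).
  exact: modr_ico.
by rewrite /modr rmorphB /=; lra.
Qed.

Lemma in_pieceE (i : 'I_n) (x : R) :
  in_piece i x = (0 <= x - i%:R / n%:R < n%:R^-1).
Proof.
by rewrite /in_piece -natr1 mulrDl mul1r subr_ge0 ltrBlDr [_ + n%:R^-1]addrC.
Qed.

Lemma ord_invn_gt0 (i : 'I_n) : 0 < n%:R^-1 :> R.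
Proof. by rewrite invr_gt0 ltr0n; case: i => m; case: n. Qed.

Lemma Gn_group_closed : group_closed (Gn_pred R n).
Proof.
pose circ (i : 'I_n) (x : R) : ico (n%:R^-1 : R) :=
  mk_ico (modr_ico x (ord_invn_gt0 i)).
split.
  apply/asboolP; exists (fun i => circ i 0), 1%g => i x.
  have l0 := ord_invn_gt0 i; rewrite in_pieceE => xi.
  by rewrite perm1 /= (modr_id (x := 0)) ?lexx // addr0 modr_id // addrC subrK.
move=> f g /asboolP[al [s fP]] /asboolP[be [u gP]]; apply/asboolP.
exists (fun i => circ i (val (al (u^-1%g i)) - val (be (u^-1%g i)))), (u^-1 * s)%g.
move=> j y yj; pose i := u^-1%g j; have l0 := ord_invn_gt0 i.
have ui : u i = j by rewrite /i permKV.
pose w := modr n%:R^-1 (val y - j%:R / n%:R - val (be i)).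
have w0 : 0 <= w < n%:R^-1 by exact: modr_ico.
have wE : i%:R / n%:R + w - i%:R / n%:R = w by rewrite addrAC subrr add0r.
have xi : in_piece i (i%:R / n%:R + w) by rewrite in_pieceE wE.
have x01 : 0 <= i%:R / n%:R + w < 1.
  move: xi => /andP[h1 h2]; apply/andP; split.
    by apply: le_trans h1; rewrite divr_ge0 ?ler0n.
  apply: lt_le_trans h2 _; rewrite ler_pdivrMr; last by rewrite -invr_gt0.
  by rewrite mul1r ler_nat ltn_ord.
pose x : ico (1 : R) := mk_ico x01.
have gx : g x = y.
  apply: val_inj; rewrite (gP i) //= ui wE modrDm // subrK.
  by move: yj; rewrite in_pieceE => yj; rewrite modr_id // addrC subrK.
have -> : (f * g^-1)%g y = f x by rewrite ietM -gx iet_funK.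
rewrite (fP i) //= permM -/i wE modrDm //.
congr (_ + _); rewrite [in RHS]addrC modrDm //.
by congr (modr _ _); rewrite [RHS]addrC addrA addrAC.
Qed.

End GnClosed.

Record Gn (R : realType) (n : nat) := MkGn {
  Gn_val :> iet R;
  Gn_valP : Gn_val \in Gn_pred R n }.

HB.instance Definition _ (R : realType) (n : nat) :=
  [isSub for @Gn_val R n].
HB.instance Definition _ (R : realType) (n : nat) := [Choice of Gn R n by <:].
HB.instance Definition _ (R : realType) (n : nat) :=
  SubChoice_isSubGroup.Build (iet R) (Gn_pred R n) (Gn R n)
    (@Gn_group_closed R n).

Section GnData.
Variables (R : realType) (n : nat) (n0 : (0 < n)%N).
Local Notation l := (n%:R^-1 : R).
Let l0 : 0 < l. Proof. by rewrite invr_gt0 ltr0n. Qed.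
Let ico1 := @ico R 1.

Lemma piece_uniq (i j : 'I_n) (x : R) : in_piece i x -> in_piece j x -> i = j.
Proof.
have np : 0 < n%:R :> R by rewrite ltr0n.
have key (a b : 'I_n) : in_piece a x -> in_piece b x -> (a <= b)%N.
  move=> /andP[h1 _] /andP[_ h2].
  have := le_lt_trans h1 h2; rewrite ltr_pM2r // ltr_nat //.
by move=> hi hj; apply: val_inj; apply/eqP; rewrite eqn_leq !key.
Qed.

Lemma piece_ex (x : ico1) : {i : 'I_n | in_piece i (val x)}.
Proof.
have np : 0 < n%:R :> R by rewrite ltr0n.
case: x => x /= /andP[x0 x1].
apply: cid; pose k := Num.truncn (x * n%:R).
have xn : 0 <= x * n%:R by rewrite mulr_ge0 // ler0n.
have /andP[h1 h2] := truncn_itv xn.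
have kn : (k < n)%N.
  rewrite -(ltr_nat R); apply: le_lt_trans h1 _.
  by rewrite -ltr_pdivlMr // divff ?gt_eqF.
exists (Ordinal kn); rewrite /in_piece /=.
by rewrite ler_pdivrMr // ltr_pdivlMr // h1 h2.
Qed.

Definition idx (x : ico1) : 'I_n := let: exist i _ := piece_ex x in i.
Lemma idxP x : in_piece (idx x) (val x).
Proof. by rewrite /idx; case: piece_ex. Qed.

Lemma put_ico (i : 'I_n) (w : R) : 0 <= w < l -> 0 <= i%:R / n%:R + w < 1.
Proof.
move=> w0.
have : in_piece i (i%:R / n%:R + w) by rewrite in_pieceE addrAC subrr add0r.
move=> /andP[h1 h2]; apply/andP; split.
  by apply: le_trans h1; rewrite divr_ge0 ?ler0n.
apply: lt_le_trans h2 _; rewrite ler_pdivrMr; last by rewrite -invr_gt0.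
by rewrite mul1r ler_nat ltn_ord.
Qed.

Definition rot (al : 'I_n -> R) (s : 'I_n -> 'I_n) (x : ico1) : ico1 :=
  mk_ico (put_ico (s (idx x))
    (modr_ico (val x - (idx x)%:R / n%:R + al (idx x)) l0)).

Lemma rotK al s be u : cancel s u -> (forall i, be (s i) = - al i) ->
  cancel (rot al s) (rot be u).
Proof.
move=> su ab x; apply: val_inj => /=.
set i := idx x; set w := modr _ (_ + al i).
have w0 : 0 <= w < l by exact: modr_ico.
have -> : idx (rot al s x) = s i.
  apply: (@piece_uniq _ _ (val (rot al s x))); first exact: idxP.
  by rewrite in_pieceE /= -/i -/w addrAC subrr add0r.
have wE : (s i)%:R / n%:R + w - (s i)%:R / n%:R = w by rewrite addrAC subrr add0r.
rewrite su ab wE.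
rewrite modrDm // addrK modr_id -?in_pieceE ?idxP //.
by rewrite addrC subrK.
Qed.

Lemma rot_pt al s : (forall i, 0 <= al i < l) -> piecewise_translation (rot al s).
Proof.
move=> al0.
pose A (p : 'I_n * bool) : R :=
  if p.2 then p.1%:R / n%:R + l - al p.1 else p.1%:R / n%:R.
pose B (p : 'I_n * bool) : R :=
  if p.2 then p.1%:R / n%:R + l else p.1%:R / n%:R + l - al p.1.
pose t (p : 'I_n * bool) : R :=
  (s p.1)%:R / n%:R - p.1%:R / n%:R + al p.1 - (if p.2 then l else 0).
have inp p x : A p <= x < B p -> in_piece p.1 x.
  rewrite in_pieceE /A /B; have := al0 p.1; case: p.2; lra.
exists {p : 'I_n * bool | A p < B p}, (fun p => A (val p)),
  (fun p => B (val p)), (fun p => t (val p)); split.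
- case=> p /= AB.
  have : 0 <= A p /\ B p <= 1; last by case.
  have i0 : 0 <= p.1%:R / n%:R :> R by rewrite divr_ge0 ?ler0n.
  have i1 : p.1%:R / n%:R + l <= 1.
    rewrite -[X in _ + X]mul1r -mulrDl natr1 ler_pdivrMr; last by rewrite -invr_gt0.
    by rewrite mul1r ler_nat ltn_ord.
  have := al0 p.1; move: AB; rewrite /A /B; case: p.2; lra.
- move=> x.
  have [p xp] : exists p, A p <= val x < B p.
    have := idxP x; rewrite in_pieceE => xi.
    have := al0 (idx x) => ai.
    case: (ltP (val x) ((idx x)%:R / n%:R + l - al (idx x))) => h.
      exists (idx x, false); rewrite /A /B /=; case/andP: xi => xi1 xi2; rewrite h andbT -subr_ge0 //.
    exists (idx x, true); rewrite /A /B /=; case/andP: xi => xi1 xi2; rewrite h /= -ltrBlDl //.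
  have AB : A p < B p by case/andP: xp; exact: le_lt_trans.
  exists (exist _ p AB); split=> //= -[q qAB] /= xq; apply: val_inj => /=.
  have := piece_uniq (inp _ _ xp) (inp _ _ xq).
  case: p q xp xq {AB qAB} => i b [j c] xp xq /= ij; rewrite -ij in xq *.
  congr (_, _); move: xp xq; rewrite /A /B; have := al0 i; case: b; case: c => //= ai xp xq; exfalso; clear ij; lra.
- case=> p AB x /= xp.
  have xi := inp _ _ xp.
  have -> : idx x = p.1 by apply: piece_uniq xi; exact: idxP.
  have := al0 p.1; move: xp xi; rewrite in_pieceE /A /B /t.
  case: p.2 => xp xi ai.
    rewrite (@modr_uniq _ _ _ (sval x - p.1%:R / n%:R + al p.1 - l) 1); [lra|lra|by rewrite mulr1z mulr1 subrK].
  by rewrite modr_id /=; [|change (\val x) with (sval x)]; lra.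
Qed.

(* Every pair (alpha, sigma) is realised by an element of Gn. *)
Lemma Gn_exists (al : 'I_n -> ico l) (s : 'S_n) :
  exists g : Gn R n, rotates_pieces al s g.
Proof.
have bij : bijective (rot (fun i => val (al i)) s).
  exists (rot (fun j => - val (al (s^-1%g j))) (s^-1)%g).
    by apply: rotK => [|i]; [exact: permK|rewrite permK].
  by apply: rotK => [|i]; [exact: permKV|rewrite opprK].
have pt : piecewise_translation (rot (fun i => val (al i)) s).
  by apply: rot_pt => i; exact: valP (al i).
have H : rotates_pieces al s (Iet bij pt).
  move=> i x xi /=; have -> : idx x = i by apply: piece_uniq xi; exact: idxP.
  by [].
have G : Iet bij pt \in Gn_pred R n by apply/asboolP; exists al, s.
by exists (MkGn G).
Qed.
End GnData.

(* Main.v *)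
Require Import Defs.
From mathcomp Require Import all_boot all_order all_fingroup all_algebra.
From mathcomp Require Import boolp classical_sets reals.

Set Implicit Arguments.
Unset Strict Implicit.
Unset Printing Implicit Defensive.

Import Order.TTheory GRing.Theory Num.Theory.
Local Open Scope ring_scope.

(* G_n consists of the bijections of [0, 1) that commute with the             *)
(* simultaneous rotations of all the pieces by a common amount. So f makes    *)
(* the abelian group H = R x Z act on [0, 1), and g f g^-1 = f^-1 with g in   *)
(* G_n says that g is equivariant up to the automorphism tau (a, k) = (a, -k) *)
(* of H; an involution with that property is wanted. Since g turns the        *)
(* stabiliser S of a point into tau S, it suffices to use g on the points     *)
(* whose stabiliser is a chosen one of S and tau S, and g^-1 on the others,   *)
(* as long as S <> tau S. When S = tau S, each orbit has its own              *)
(* tau-equivariant involution h r |-> tau(h) r, for a base point r.           *)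

(** Membership in G_n is purely an equivariance condition, by [Gn_piece_rotation] and
    [piece_rotation_commuting_Gn]: an injection commuting with the piece rotations is determined by
    the images of the left endpoints of the pieces, so it is automatically an interval exchange. The
    involution may therefore be assembled orbit by orbit by arbitrary choices, without regard to
    continuity. [twisted_involution] does this for any action of an abelian group with an involutive
    automorphism; its equivariance at (a, 0) and at (0, 1) gives back membership in G_n and the
    inversion of f. *)

Section TwistedAction.
Local Open Scope classical_set_scope.
Variables (H : zmodType) (X : choiceType) (act : H -> X -> X) (tau : H -> H).
Hypothesis act0 : forall x, act 0 x = x.
Hypothesis actD : forall h k x, act (h + k) x = act h (act k x).
Hypothesis tauD : {morph tau : h k / h + k}.
Hypothesis tauK : involutive tau.

Definition twisted (g : X -> X) := forall h x, g (act h x) = act (tau h) (g x).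

Definition stab (x : X) : set H := [set h | act h x = x].

Definition twist (S : set H) : set H := tau @^-1` S.

Lemma actK h : cancel (act h) (act (- h)).
Proof. by move=> x; rewrite -actD addNr act0. Qed.

Lemma twistK : involutive twist.
Proof. by move=> S; apply/funext => h; rewrite /twist /preimage /= tauK. Qed.

Lemma tauB h k : tau (h - k) = tau h - tau k.
Proof. by apply: (addIr (tau k)); rewrite -tauD !subrK. Qed.

(** As H is commutative, conjugation does not move stabilisers; a rule that depends only on [stab x]
    is thus constant on orbits. *)
Lemma stab_act h x : stab (act h x) = stab x.
Proof.
apply/funext => k; apply/propext; rewrite /stab /= -actD addrC actD.
by split=> [/(can_inj (actK h))//|->].
Qed.

Lemma stab_twisted g x : injective g -> twisted g ->
  stab (g x) = twist (stab x).
Proof.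
move=> gI gT; apply/funext => h; apply/propext.
by rewrite /twist /stab /= -[h in act h (g x)]tauK -gT; split=> [/gI|->].
Qed.

Lemma twisted_can g g' : cancel g g' -> cancel g' g -> twisted g -> twisted g'.
Proof. by move=> gK g'K gT h x; apply: (canLR gK); rewrite gT tauK g'K. Qed.

(** This makes [orbit_flip] independent of which coordinate h is picked for a point h r of the
    orbit. *)
Lemma act_tau_eq h k x : stab x = twist (stab x) ->
  act h x = act k x -> act (tau h) x = act (tau k) x.
Proof.
move=> xS hk; have : twist (stab x) (h - k).
  by rewrite -xS /stab /= addrC actD hk actK.
rewrite /twist /stab /= tauB => E.
by rewrite -[in LHS](subrK (tau k) (tau h)) addrC actD E.
Qed.

(** [choose] returns the same point for equivalent predicates, whatever the witness, so the base
    point depends on the orbit alone. *)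
Definition orbit_base (x : X) : X :=
  choose (fun y => `[< exists h, y = act h x >]) x.

Lemma orbit_baseP x : exists h, act h (orbit_base x) = x.
Proof.
have /asboolP[h E] : `[< exists h, orbit_base x = act h x >].
  by apply: (chooseP (P := fun y => `[< exists h, y = act h x >]));
    apply/asboolP; exists 0.
by exists (- h); rewrite E actK.
Qed.

Lemma orbit_base_act h x : orbit_base (act h x) = orbit_base x.
Proof.
rewrite /orbit_base; set P := fun y => `[< exists k, y = act k x >].
rewrite (@eq_choose _ _ P) => [|y]; last first.
  apply/asboolP/asboolP => -[k ->]; first by exists (k + h); rewrite actD.
  by exists (k - h); rewrite actD actK.
by apply: choose_id; apply/asboolP; [exists h | exists 0].
Qed.

Definition orbit_coord (x : X) : H := projT1 (cid (orbit_baseP x)).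

Lemma orbit_coordK x : act (orbit_coord x) (orbit_base x) = x.
Proof. by rewrite /orbit_coord; case: cid. Qed.

Lemma stab_orbit_base x : stab (orbit_base x) = stab x.
Proof. by rewrite -[x in RHS]orbit_coordK stab_act. Qed.

Definition orbit_flip (x : X) : X := act (tau (orbit_coord x)) (orbit_base x).

Lemma orbit_flipE h x : stab x = twist (stab x) ->
  orbit_flip (act h (orbit_base x)) = act (tau h) (orbit_base x).
Proof.
move=> xS; rewrite /orbit_flip; set y := act h _.
have yE : orbit_base y = orbit_base x.
  by rewrite -[x in RHS]orbit_coordK !orbit_base_act.
rewrite yE; apply: act_tau_eq; first by rewrite stab_orbit_base.
by rewrite -[in LHS]yE orbit_coordK.
Qed.

Lemma orbit_flip_act h x : stab x = twist (stab x) ->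
  orbit_flip (act h x) = act (tau h) (orbit_flip x).
Proof.
by move=> xS; rewrite -[x in LHS]orbit_coordK -actD orbit_flipE // tauD actD.
Qed.

Lemma orbit_flipK x : stab x = twist (stab x) -> orbit_flip (orbit_flip x) = x.
Proof.
move=> xS; rewrite [orbit_flip x in LHS]/orbit_flip orbit_flipE //.
by rewrite tauK orbit_coordK.
Qed.

(* The same element of {S, tau S} is chosen from S and from tau S. *)
Definition twist_rep (S : set H) : set H := choose (pred2 S (twist S)) S.

Lemma twist_repP S : twist_rep S = S \/ twist_rep S = twist S.
Proof.
have : pred2 S (twist S) (twist_rep S) by apply: chooseP; rewrite /= eqxx.
by case/orP => /eqP; [left | right].
Qed.

Lemma twist_rep_twist S : twist_rep (twist S) = twist_rep S.
Proof.
rewrite /twist_rep twistK (@eq_choose _ _ (pred2 S (twist S))) => [|T].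
  by apply: choose_id; rewrite /= eqxx ?orbT.
by rewrite /= orbC.
Qed.

Lemma twisted_involution g g' : cancel g g' -> cancel g' g -> twisted g ->
  exists b, twisted b /\ involutive b.
Proof.
move=> gK g'K gT; have g'T := twisted_can gK g'K gT.
have gS x := stab_twisted x (can_inj gK) gT.
have g'S x := stab_twisted x (can_inj g'K) g'T.
exists (fun x => if stab x == twist (stab x) then orbit_flip x
  else if twist_rep (stab x) == stab x then g x else g' x).
split=> [h x|x]; first rewrite stab_act.
  case: eqVneq => [|_]; first exact: orbit_flip_act.
  by case: ifP => _; [exact: gT | exact: g'T].
have [xS|xS] := eqVneq (stab x) (twist (stab x)).
  have fS : stab (orbit_flip x) = stab x by rewrite stab_act stab_orbit_base.
  by rewrite fS -xS eqxx orbit_flipK.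
(* The stabilisers of x and of its image are S and tau S, which differ but share their
   representative; so if x is moved by one of [g], [g'], its image is moved by the other. *)
have [xR|xR] := eqVneq (twist_rep (stab x)) (stab x).
  by rewrite gS twistK twist_rep_twist xR eq_sym (negPf xS) gK.
have [|tR] := twist_repP (stab x); first by move/eqP; rewrite (negPf xR).
by rewrite g'S twistK twist_rep_twist tR eq_sym (negPf xS) eqxx g'K.
Qed.

End TwistedAction.

(** * Integer iterates of a bijection *)

Section IntIteration.
Variables (X : Type) (f f' : X -> X).
Hypotheses (fK : cancel f f') (f'K : cancel f' f).

Definition iterz (k : int) : X -> X :=
  match k with Posz m => iter m f | Negz m => iter m.+1 f' end.

Lemma iterz1D k x : iterz (1 + k) x = f (iterz k x).
Proof.
by case: k => [m|[|m]] //; rewrite /= f'K subn1.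
Qed.

Lemma iterzN1D k x : iterz (- 1 + k) x = f' (iterz k x).
Proof. by rewrite -[k in RHS](addNKr 1) iterz1D fK. Qed.

Lemma iterzD j k x : iterz (j + k) x = iterz j (iterz k x).
Proof.
elim/int_ind: j => [|m IH|m IH]; first by rewrite add0r.
  by rewrite -add1n PoszD -addrA !iterz1D IH.
by rewrite -add1n PoszD opprD -addrA !iterzN1D IH.
Qed.

Lemma iterz_conj g k x : (forall y, g (f y) = f' (g y)) ->
  g (iterz k x) = iterz (- k) (g x).
Proof.
move=> gf; have gf' y : g (f' y) = f (g y).
  by rewrite -[in RHS](f'K y) gf f'K.
elim/int_ind: k => [|m IH|m IH] //.
  by rewrite -add1n PoszD opprD iterz1D iterzN1D gf IH.
by rewrite -add1n PoszD opprK opprD iterz1D iterzN1D gf' IH opprK.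
Qed.

End IntIteration.

(** * G_n as the centraliser of the piece rotations *)

Section PieceRotations.
Variables (R : realType) (n : nat) (n0 : (0 < n)%N).
Local Notation l := (n%:R^-1 : R).
Local Notation interval := (ico (1 : R)).
Local Notation idx := (@idx R n n0).
Local Notation rot := (@Defs.rot R n n0).

Lemma invn_gt0 : 0 < l. Proof. by rewrite invr_gt0 ltr0n. Qed.

Definition offset (x : interval) : R := val x - (idx x)%:R / n%:R.

Lemma offset_itv x : 0 <= offset x < l.
Proof. by rewrite -in_pieceE; exact: idxP. Qed.

Lemma idx_offset_inj x y : idx x = idx y -> offset x = offset y -> x = y.
Proof.
by rewrite /offset => xy /eqP; rewrite xy (inj_eq (addIr _)) => /eqP/val_inj.
Qed.

Lemma idx_unique i x : in_piece i (val x) -> idx x = i.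
Proof. exact/(piece_uniq n0)/idxP. Qed.

Lemma idx_rot al s x : idx (rot al s x) = s (idx x).
Proof.
apply: idx_unique; rewrite in_pieceE /= addrAC subrr add0r.
exact/modr_ico/invn_gt0.
Qed.

Lemma offset_rot al s x :
  offset (rot al s x) = modr l (offset x + al (idx x)).
Proof. by rewrite {1}/offset idx_rot /= addrAC subrr add0r. Qed.

(** The angle is any real, multiples of 1/n acting trivially, so that the acting group is R itself
    rather than the circle. *)
Definition piece_rotation (a : R) := rot (fun=> a) id.

Lemma piece_rotation0 x : piece_rotation 0 x = x.
Proof.
apply: idx_offset_inj; rewrite ?idx_rot ?offset_rot //.
by rewrite addr0 modr_id // offset_itv.
Qed.

Lemma piece_rotationD a b x :
  piece_rotation (a + b) x = piece_rotation a (piece_rotation b x).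
Proof.
apply: idx_offset_inj; rewrite ?idx_rot ?offset_rot //.
by rewrite modrDm ?invn_gt0 // [a + b]addrC addrA.
Qed.

Lemma rot_piece_rotation al s a x :
  rot al s (piece_rotation a x) = piece_rotation a (rot al s x).
Proof.
apply: idx_offset_inj; rewrite ?idx_rot ?offset_rot ?idx_rot //.
by rewrite !modrDm ?invn_gt0 // addrAC.
Qed.

Lemma Gn_piece_rotation (g : Gn R n) a x :
  g (piece_rotation a x) = piece_rotation a (g x).
Proof.
have /asboolP[al [s gP]] := Gn_valP g.
have gE y : g y = rot (fun i => val (al i)) s y.
  by apply: val_inj; rewrite (gP _ _ (idxP n0 y)).
by rewrite !gE rot_piece_rotation.
Qed.

Definition piece_start (i : 'I_n) : interval :=
  mk_ico (put_ico n0 i (modr_ico 0 invn_gt0)).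

Lemma idx_piece_start i : idx (piece_start i) = i.
Proof.
apply: idx_unique; rewrite in_pieceE /= addrAC subrr add0r.
exact/modr_ico/invn_gt0.
Qed.

Lemma offset_piece_start i : offset (piece_start i) = 0.
Proof.
by rewrite /offset idx_piece_start /= addrAC subrr add0r modr_id // lexx invn_gt0.
Qed.

Lemma eq_piece_rotation x y : idx x = idx y ->
  piece_rotation (offset y - offset x) x = y.
Proof.
move=> xy; apply: idx_offset_inj; rewrite ?idx_rot ?offset_rot //.
by rewrite addrC subrK modr_id // offset_itv.
Qed.

Lemma piece_rotation_commuting_Gn (b : interval -> interval) :
  injective b -> (forall a x, b (piece_rotation a x) = piece_rotation a (b x)) ->
  exists g : Gn R n, g =1 b.
Proof.
move=> bI bR; pose s i := idx (b (piece_start i)).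
(* If two left endpoints land in the same piece, a rotation joins their images; pulled back through
   [b], it joins the endpoints themselves, so their pieces agree. *)
have sI : injective s.
  move=> i j /eq_piece_rotation; rewrite -bR => /bI /(congr1 idx).
  by rewrite idx_rot !idx_piece_start.
pose al i : ico l := mk_ico (offset_itv (b (piece_start i))).
have [g gP] := Gn_exists n0 al (perm sI); exists g => x.
have gE : g x = rot (fun i => val (al i)) s x.
  by apply: val_inj; rewrite (gP _ _ (idxP n0 x)) permE.
(* Rotations are transitive on each piece, so the values of [b] at the left endpoints determine
   [b]. *)
have xE : piece_rotation (offset x) (piece_start (idx x)) = x.
  rewrite -[offset x]subr0 -(offset_piece_start (idx x)).
  by rewrite eq_piece_rotation // idx_piece_start.
rewrite gE -[in RHS]xE bR; apply: idx_offset_inj; rewrite ?idx_rot ?offset_rot //.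
by rewrite addrC.
Qed.

End PieceRotations.

Theorem theorem2 (R : realType) (n : nat) (n_ge1 : (1 <= n)%N) (f : Gn R n) :
  reversible f -> strongly_reversible f.
Proof.
move=> [g gf].
have mulE (u v : Gn R n) x : (u * v)%g x = u (v x) by [].
have GnK (u : Gn R n) : cancel u (u^-1)%g.
  by move=> x; rewrite -mulE mulVg.
have GnVK (u : Gn R n) : cancel (u^-1)%g u.
  by move=> x; rewrite -mulE mulgV.
have Gn_eq (u v : Gn R n) : u =1 v -> u = v by move=> uv; exact/val_inj/iet_eqP.
have gfE x : g (f x) = (f^-1)%g (g x) by rewrite -!mulE -gf mulgVK.
pose H : zmodType := (R * int)%type.
pose act (h : H) x := piece_rotation n_ge1 h.1 (iterz f (f^-1)%g h.2 x).
pose tau (h : H) : H := (h.1, - h.2).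
have rot_iter a k x : iterz f (f^-1)%g k (piece_rotation n_ge1 a x)
    = piece_rotation n_ge1 a (iterz f (f^-1)%g k x).
  elim/int_ind: k => [|m IH|m IH] //; rewrite -add1n PoszD ?opprD.
    by rewrite !(iterz1D (GnVK f)) IH Gn_piece_rotation.
  by rewrite !(iterzN1D (GnK f) (GnVK f)) IH Gn_piece_rotation.
have act0 x : act 0 x = x by rewrite /act piece_rotation0.
have actD h k x : act (h + k) x = act h (act k x).
  by rewrite /act rot_iter -piece_rotationD -(iterzD (GnK f) (GnVK f)).
have tauD : {morph tau : h k / h + k} by move=> h k; rewrite /tau /= opprD.
have tauK : involutive tau by case=> a k; rewrite /tau /= opprK.
have gT : twisted act tau g.
  by move=> h x; rewrite /act Gn_piece_rotation (iterz_conj (GnK f) (GnVK f)).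
have [b [bT bK]] :=
  twisted_involution act0 actD tauD tauK (GnK g) (GnVK g) gT.
(* [tau] fixes (a, 0) and sends (0, 1) to (0, -1). *)
have bR a x : b (piece_rotation n_ge1 a x) = piece_rotation n_ge1 a (b x).
  exact: bT (a, 0) x.
have bf x : b (f x) = (f^-1)%g (b x).
  by have := bT (0, 1) x; rewrite /act /= !piece_rotation0.
have [u uE] := piece_rotation_commuting_Gn (inv_inj bK) bR.
exists u; split; last by apply: Gn_eq => x; rewrite expg2 mulE !uE bK.
apply: (canLR (mulgK _)); apply: Gn_eq => x.
by rewrite !mulE !uE bf.
Qed.
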